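(* Let $i,j\in[n-1]$ be nonconsecutive (i.e. $|i-j|\ne 1$). If $\pi=\pi_1\cdots\pi_n\in\mathfrak{S}_n$, viewed as the tuple $(\pi_1,\ldots,\pi_n)\in\mathrm{UFR}_n$, then $\delta_i(\delta_j(\pi))=\delta_j(\delta_i(\pi))$.
   Context: $[n]=\{1,\ldots,n\}$. Parking process: $\alpha=(a_1,\ldots,a_n)\in[n]^n$ encodes preferences of cars $1,\ldots,n$ arriving in order at a one-way street with spots $1,\ldots,n$; car $i$ parks in spot $a_i$ if free, otherwise in the first free spot after $a_i$, if any. $\alpha$ is a parking function if all cars park. A unit interval parking function is a parking function in which each car $i$ parks in spot $a_i$ or $a_i+1$. A Fubini ranking is a tuple $(r_1,\ldots,r_n)\in[n]^n$ with $r_i=1+|\{j:r_j<r_i\}|$ for all $i$. $\mathrm{UFR}_n$ is the set of tuples that are both Fubini rankings and unit interval parking functions (unit Fubini rankings); every permutation in one-line notation belongs to it. For $i\in[n-1]$, $\delta_i:\mathrm{UFR}_n\to\mathrm{UFR}_n$ is defined by $\delta_i(\alpha)=\alpha$ if some value among $i-1,i,i+1$ occurs exactly twice in $\alpha$, and otherwise $\delta_i(\alpha)$ is obtained from $\alpha$ by decreasing the single occurrence of $i+1$ to $i$. *)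

(* Defs.v *)
From HB Require Import structures.
From mathcomp Require Import all_boot all_fingroup.
From mathcomp Require Import zify.

Set Implicit Arguments.
Unset Strict Implicit.
Unset Printing Implicit Defensive.

(* Preferences, ranks and spots are natural numbers ranging over 1, ..., n;
   only the positions in a tuple (the cars) are numbered from 0. *)
Definition in_range (n : nat) (alpha : n.-tuple nat) : bool :=
  [forall k, 1 <= tnth alpha k <= n].

(* First spot of the list a, a+1, ..., n which is not occupied, if any. *)
Definition park (n : nat) (occ : seq nat) (a : nat) : option nat :=
  ohead [seq x <- iota a (n.+1 - a) | x \notin occ].

(* Spots of the successive cars with preferences s, the spots of occ being
   already occupied; None marks a car that fails to park. *)
Fixpoint outcome (n : nat) (occ s : seq nat) : seq (option nat) :=
  if s is a :: s' then
    let p := park n occ a in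
    p :: outcome n (if p is Some x then x :: occ else occ) s'
  else [::].

Definition spot (n : nat) (alpha : n.-tuple nat) (k : 'I_n) : option nat :=
  nth None (outcome n [::] alpha) k.

Definition parking_function (n : nat) (alpha : n.-tuple nat) : bool :=
  in_range alpha && [forall k, isSome (spot alpha k)].

Definition unit_interval_parking_function (n : nat) (alpha : n.-tuple nat) :
    bool :=
  parking_function alpha &&
  [forall k, (spot alpha k == Some (tnth alpha k)) ||
             (spot alpha k == Some (tnth alpha k).+1)].

Definition fubini_ranking (n : nat) (r : n.-tuple nat) : bool :=
  in_range r &&
  [forall k, tnth r k == 1 + #|[set l | tnth r l < tnth r k]|].

Definition unit_fubini_ranking (n : nat) (alpha : n.-tuple nat) : bool :=
  fubini_ranking alpha && unit_interval_parking_function alpha.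

Definition UFR (n : nat) := {alpha : n.-tuple nat | unit_fubini_ranking alpha}.

(* For i = 1 the value i.-1 = 0 never occurs in a tuple with values in [n].
   In the second branch i.+1 occurs exactly once when alpha is in UFR_n and
   0 < i < n (delta_single below), so at most one entry changes. *)
Definition delta_tuple (n i : nat) (alpha : n.-tuple nat) : n.-tuple nat :=
  if has (fun v => count_mem v alpha == 2) [:: i.-1; i; i.+1] then alpha
  else map_tuple (fun a => if a == i.+1 then i else a) alpha.

(* The rest of the file shows that delta_tuple maps UFR_n to itself and that
   permutations belong to UFR_n, via: a Fubini ranking is a unit interval
   parking function iff each of its values occurs at most twice. *)

Section Counting.

(* simpl makes the implicit type nat of count syntactically uniform for lia. *)
Local Ltac slia := intros; simpl Equality.sort in *; lia.

Implicit Types (s p q occ : seq nat) (n i k v a : nat).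

Definition fubini_seq s :=
  all (fun a => (1 <= a <= size s) && (a == (count (fun b => b < a) s).+1)) s.

Lemma count_leS s k :
  count (fun b => b <= k.+1) s = count (fun b => b <= k) s + count_mem k.+1 s.
Proof. by elim: s => //= b s ->; case: (ltngtP b k.+1) => ?; slia. Qed.

Lemma count_lt_le s k :
  0 < k -> count (fun b => b < k) s = count (fun b => b <= k.-1) s.
Proof. by move=> k0; apply: eq_count => b; slia. Qed.

Lemma count_mem_gt0 s v : (0 < count_mem v s) = (v \in s).
Proof. by rewrite -has_count has_pred1. Qed.

Lemma fubini_count s v : fubini_seq s -> v \in s ->
  0 < v <= size s /\ count (fun b => b <= v.-1) s = v.-1.
Proof.
move=> /allP F vs; have /andP[r /eqP e] := F _ vs.
split=> //; rewrite -count_lt_le; slia.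
Qed.

Lemma fubini_cumul s k : fubini_seq s -> (forall v, count_mem v s <= 2) ->
  k <= size s ->
  count (fun b => b <= k) s = k \/
  count (fun b => b <= k) s = k.+1 /\ count_mem k s = 2.
Proof.
move=> F c2; elim: k => [|k IH] lek.
  left; rewrite -[RHS](count_pred0 s); apply: eq_in_count => b bs /=.
  by have [/andP[b0 _] _] := fubini_count F bs; case: b b0 {bs}.
rewrite count_leS; have := c2 k.+1.
have [kin|knin] := boolP (k.+1 \in s).
  have [_ /= ->] := fubini_count F kin; move: kin; rewrite -count_mem_gt0.
  by case: (count_mem k.+1 s) => [|[|[|c]]] //; [left|right]; rewrite ?addn1 ?addn2.
have -> : count_mem k.+1 s = 0 by apply/count_memPn.
move=> _; case: (IH (ltnW lek)) => [e|[e _]]; last by left; slia.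
have ex : exists w, (k < w) && (w \in s).
  have : has (predC (fun b => b <= k)) s.
    by rewrite has_count; have := count_predC (fun b => b <= k) s; slia.
  by case/hasP=> w ws /= kw; exists w; rewrite ws andbT; slia.
case: (ex_minnP ex) => w /andP[kw ws] wmin.
have [_ ew] := fubini_count F ws.
have e2 : count (fun b => b <= w.-1) s = count (fun b => b <= k) s.
  apply: eq_in_count => b bs /=; apply/idP/idP => [|?]; last by slia.
  by move=> bw; rewrite leqNgt; apply/negP => kb; have := wmin b; rewrite kb bs; slia.
by case/negP: knin; have <- : w = k.+1 by slia.
Qed.

Lemma fubini_single s i : fubini_seq s -> (forall v, count_mem v s <= 2) ->
  0 < i < size s ->
  ~~ has (fun v => count_mem v s == 2) [:: i.-1; i; i.+1] ->
  [/\ count_mem i s = 1, count_mem i.+1 s = 1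
    & count (fun b => b < i) s = i.-1].
Proof.
move=> F c2 /andP[i0 ilt] /=; rewrite orbF !negb_or => /and3P[/eqP n1 /eqP n2 /eqP n3].
have ilt' := ltnW ilt.
have ipl : i.-1 <= size s by slia.
have [e3|[_ /n3//]] := fubini_cumul F c2 ilt.
have [e2|[_ /n2//]] := fubini_cumul F c2 ilt'.
have [e1|[_ /n1//]] := fubini_cumul F c2 ipl.
have := count_leS s i; have := count_leS s i.-1.
by rewrite prednK // count_lt_le //; split; slia.
Qed.

Lemma fubini_decrease s i : fubini_seq s -> (forall v, count_mem v s <= 2) ->
  0 < i < size s ->
  ~~ has (fun v => count_mem v s == 2) [:: i.-1; i; i.+1] ->
  let t := [seq (if a == i.+1 then i else a) | a <- s] in
  fubini_seq t /\ (forall v, count_mem v t <= 2).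
Proof.
move=> F c2 iP nd t; have [ci cS ei] := fubini_single F c2 iP nd; split.
  rewrite /fubini_seq size_map; apply/allP => _ /mapP[b bs ->].
  rewrite count_map; have /allP/(_ b bs)/andP[r /eqP e] := F.
  case: (eqVneq b (i.+1)) => [_|nb].
    rewrite (@eq_count _ _ (fun x => x < i)) ?ei; first by slia.
    by move=> x /=; case: (eqVneq x i.+1); slia.
  rewrite r {1}e eqSS; apply/eqP/eq_in_count => x _ /=.
  by case: (eqVneq x i.+1); slia.
move=> v; rewrite count_map.
case: (eqVneq v i) => [->|nv].
  suff -> : count (preim (fun a => if a == i.+1 then i else a) (pred1 i)) s
          = count_mem i s + count_mem i.+1 s by slia.
  elim: (s) => //= b u ->.
  by case: (eqVneq b i.+1) => [->|nb]; rewrite ?eqxx /=; slia.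
apply: leq_trans (c2 v); apply: sub_count => x /=.
by case: (eqVneq x i.+1) => // _ /eqP; slia.
Qed.

Definition unit_outcome n occ s :=
  all2 (fun a o => (o == Some a) || (o == Some a.+1)) s (outcome n occ s).

Lemma park_notin n occ a x : park n occ a = Some x -> x \notin occ.
Proof.
rewrite /park; set l := filter _ _ => e.
suff : x \in l by rewrite mem_filter => /andP[].
by case: l e => //= y l [->]; rewrite mem_head.
Qed.

Lemma park_free n occ a : a <= n -> a \notin occ -> park n occ a = Some a.
Proof. by move=> an aocc; rewrite /park subSn //= aocc. Qed.

Lemma park_next n occ a : a < n -> a \in occ -> a.+1 \notin occ ->
  park n occ a = Some a.+1.
Proof.
move=> an aocc socc; rewrite /park subSn ?(ltnW an) //= aocc /=.
by rewrite -subSS subSn //= socc.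
Qed.

Lemma unit_count n occ s : uniq occ -> unit_outcome n occ s ->
  exists2 occ', uniq occ' &
    forall v, count_mem v s + count (pred2 v v.+1) occ
              <= count (pred2 v v.+1) occ'.
Proof.
elim: s occ => [|a s IH] occ u /=; first by exists occ.
rewrite /unit_outcome /=; case e: (park n occ a) => [x|] //= /andP[xa].
have u' : uniq (x :: occ) by rewrite /= u (park_notin e).
case/(IH _ u') => occ' uo le; exists occ' => // v.
have := le v; move: xa => /=; rewrite !(inj_eq Some_inj).
by case: (eqVneq a v) => [->|_]; [move=> -> | ]; slia.
Qed.

Lemma unit_count2 n s v : unit_outcome n [::] s -> count_mem v s <= 2.
Proof.
case/unit_count => // occ u /(_ v); rewrite addn0 => le.
apply: (leq_trans le); rewrite -size_filter.
apply: (@uniq_leq_size _ _ [:: v; v.+1]); first exact: filter_uniq.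
by move=> x; rewrite mem_filter !inE => /andP[].
Qed.

Lemma fubini_unit_aux s p q occ : fubini_seq s ->
  (forall v, count_mem v s <= 2) -> s = p ++ q ->
  (forall x, (x \in occ) = (x \in p) || ((0 < x) && (1 < count_mem x.-1 p))) ->
  unit_outcome (size s) occ q.
Proof.
move=> F c2; elim: q p occ => [|a q IH] p occ es hocc //.
have as_ : a \in s by rewrite es mem_cat mem_head orbT.
have [ra ea] := fubini_count F as_.
have cs v : count_mem v s = count_mem v p + ((a == v) + count_mem v q).
  by rewrite es count_cat.
have prev : count_mem a.-1 s <= 1.
  rewrite leqNgt; apply/negP => c.
  have pin : a.-1 \in s by rewrite -count_mem_gt0; slia.
  have [rp ep] := fubini_count F pin.
  by have := count_leS s a.-1.-1; rewrite prednK; slia.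
have ha : (a \in occ) = (a \in p).
  by rewrite hocc; have := cs a.-1; case: (a \in p) => //=; slia.
have step x : x \notin occ ->
   (forall y, (y == x) || (y \in occ) =
      (y \in rcons p a) || ((0 < y) && (1 < count_mem y.-1 (rcons p a)))) ->
   unit_outcome (size s) (x :: occ) q.
  move=> xo h; apply: (IH (rcons p a)); first by rewrite cat_rcons.
  by move=> y; rewrite inE h.
have crc v : count_mem v (rcons p a) = count_mem v p + (a == v).
  by rewrite -cats1 count_cat /= addn0.
have [ap|anp] := boolP (a \in p); last first.
  have ao : a \notin occ by rewrite ha.
  have pk : park (size s) occ a = Some a by apply: park_free => //; slia.
  rewrite /unit_outcome /= pk eqxx /=; apply: step => // y.
  rewrite hocc mem_rcons inE crc orbA; congr (_ || _).
  case: (eqVneq a y.-1) => [e|_]; last by rewrite addn0.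
  have : count_mem y.-1 p = 0 by rewrite -e; apply/count_memPn.
  by move=> ->.
have ca : count_mem a p = 1.
  by move: ap; rewrite -count_mem_gt0; have := cs a; have := c2 a; rewrite eqxx; slia.
have sa : count_mem a s = 2 by have := cs a; have := c2 a; rewrite eqxx; slia.
have eS := count_leS s a.-1; rewrite prednK in eS; last by slia.
have aS : a < size s.
  by have := count_size (fun b => b <= a) s; slia.
have nS : a.+1 \notin s.
  by apply/negP => /(fubini_count F)[_ /=]; slia.
have nSp : a.+1 \notin p.
  by apply: contra nS => h; rewrite es mem_cat h.
have So : a.+1 \notin occ by rewrite hocc (negPf nSp) /= ca.
have ao : a \in occ by rewrite ha.
rewrite /unit_outcome /= (park_next aS ao So) eqxx orbT; apply: step => // y.
rewrite hocc mem_rcons inE crc.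
case: (eqVneq y a.+1) => [->|ny] /=.
  by rewrite ca eqxx orbT.
case: (eqVneq y a) => [->|nya] /=; first by rewrite ap.
case: (eqVneq a y.-1) => [e|_]; last by rewrite addn0.
by case: (posnP y) => [->|y0] //=; slia.
Qed.

Lemma fubini_unit s : fubini_seq s -> (forall v, count_mem v s <= 2) ->
  unit_outcome (size s) [::] s.
Proof.
move=> F c2; apply: (@fubini_unit_aux s [::]) => // x.
by rewrite in_nil /= andbF. Qed.

Lemma size_outcome n occ s : size (outcome n occ s) = size s.
Proof. by elim: s occ => //= a s IH occ; rewrite IH. Qed.

End Counting.

Lemma card_tnth (n : nat) (alpha : n.-tuple nat) (P : pred nat) :
  #|[set l | P (tnth alpha l)]| = count P alpha.
Proof. by rewrite cardsE -sum1_card -sum1_count big_tuple. Qed.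

Lemma unit_fubini_rankingE (n : nat) (alpha : n.-tuple nat) :
  unit_fubini_ranking alpha <->
  fubini_seq alpha /\ forall v, count_mem v alpha <= 2.
Proof.
have FE : fubini_ranking alpha = fubini_seq alpha.
  rewrite /fubini_seq size_tuple; apply/idP/idP.
    case/andP=> /forallP r /forallP e; apply/all_tnthP => k.
    by rewrite r {1}(eqP (e k)) (card_tnth alpha (fun b => b < _)) add1n /=.
  move/all_tnthP=> h; apply/andP; split; apply/forallP => k.
    by have /andP[] := h k.
  rewrite (card_tnth alpha (fun b => b < tnth alpha k)) add1n.
  by have /andP[] := h k.
have U : unit_outcome n [::] alpha =
   [forall k, (spot alpha k == Some (tnth alpha k)) ||
              (spot alpha k == Some (tnth alpha k).+1)].
  rewrite /unit_outcome all2E size_outcome eqxx /=.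
  have sz : size (zip alpha (outcome n [::] alpha)) = n.
    by rewrite size_zip size_outcome size_tuple minnn.
  apply/(all_nthP (0, None))/forallP => [h k|h k].
    have := h k; rewrite sz nth_zip ?size_outcome //= -(tnth_nth 0).
    by apply; apply: ltn_ord.
  rewrite sz => kn; have := h (Ordinal kn).
  by rewrite nth_zip ?size_outcome //= (tnth_nth 0).
rewrite /unit_fubini_ranking FE /unit_interval_parking_function -U.
split=> [/and3P[F _ u]|[F c2]]; first by split=> // v; apply: unit_count2 u.
have u : unit_outcome n [::] alpha.
  by have := fubini_unit F c2; rewrite size_tuple.
rewrite F u andbT /=; apply/andP; split; first by move: F; rewrite -FE => /andP[].
by apply/forallP => k; move: u; rewrite U => /forallP/(_ k); case: (spot _ _).
Qed.

Lemma delta_single (n i : nat) (alpha : n.-tuple nat) :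
  0 < i < n -> unit_fubini_ranking alpha ->
  ~~ has (fun v => count_mem v alpha == 2) [:: i.-1; i; i.+1] ->
  count_mem i.+1 alpha = 1.
Proof.
move=> hi /unit_fubini_rankingE[F c2] nd.
by have [] := fubini_single F c2 _ nd; rewrite ?size_tuple.
Qed.

Lemma delta_tuple_UFR (n i : nat) (alpha : n.-tuple nat) :
  0 < i < n -> unit_fubini_ranking alpha ->
  unit_fubini_ranking (delta_tuple i alpha).
Proof.
rewrite /delta_tuple => hi; case: ifPn => // nd /unit_fubini_rankingE[F c2].
apply/unit_fubini_rankingE; apply: (fubini_decrease F c2 _ nd).
by rewrite size_tuple.
Qed.

Definition perm_tuple (n : nat) (pi : 'S_n) : n.-tuple nat :=
  [tuple (pi k).+1 | k < n].

Lemma perm_tuple_UFR (n : nat) (pi : 'S_n) :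
  unit_fubini_ranking (perm_tuple pi).
Proof.
have pe : perm_eq (perm_tuple pi) (iota 1 n).
  rewrite uniq_perm ?iota_uniq //.
    rewrite map_inj_uniq ?enum_uniq //.
    by move=> k l [] /val_inj/perm_inj.
  move=> x; rewrite mem_iota; apply/mapP/idP => [[k _ ->]|].
    by rewrite add1n !ltnS ltn_ord.
  case: x => // x /andP[_]; rewrite add1n ltnS => xn; exists (pi^-1%g (Ordinal xn)).
    by rewrite mem_enum.
  by rewrite permKV.
apply/unit_fubini_rankingE; split=> [|v]; last first.
  by rewrite (seq.permP pe) count_uniq_mem ?iota_uniq //; case: (_ \in _).
apply/allP => a; rewrite (perm_mem pe) mem_iota size_tuple => /andP[a0 an].
have -> : count (fun b => b < a) (perm_tuple pi) = a.-1.
  have lo : count (fun b => b < a) (iota 1 a.-1) = a.-1.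
    rewrite -[RHS](size_iota 1); apply/eqP; rewrite -all_count.
    by apply/allP => b; rewrite mem_iota; lia.
  have hi : count (fun b => b < a) (iota (1 + a.-1) (n - a.-1)) = 0.
    rewrite -[RHS](count_pred0 (iota (1 + a.-1) (n - a.-1))).
    by apply: eq_in_count => b; rewrite mem_iota /=; lia.
  rewrite (seq.permP pe) -{1}(@subnKC a.-1 n); last by lia.
  by rewrite iotaD count_cat lo hi addn0.
by rewrite prednK // eqxx andbT; lia.
Qed.

Definition delta (n i : nat) (hi : 0 < i < n) (alpha : UFR n) : UFR n :=
  exist _ (delta_tuple i (val alpha)) (delta_tuple_UFR hi (valP alpha)).

Definition ufr_of_perm (n : nat) (pi : 'S_n) : UFR n :=
  exist _ (perm_tuple pi) (perm_tuple_UFR pi).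

(* Main.v *)
Require Import Defs.
From mathcomp Require Import all_boot all_fingroup ssrint.
From mathcomp Require Import zify.

Set Implicit Arguments.
Unset Strict Implicit.
Unset Printing Implicit Defensive.

(* On a tuple without repetitions delta_j lowers j+1 to j, after which j is the
   only repeated value.  If |i - j| <> 1 and i <> j, then j is not one of
   i-1, i, i+1, so delta_i still acts by lowering i+1 to i, and the two
   lowerings commute because they involve disjoint sets of values. *)

Definition lower (i a : nat) : nat := if a == i.+1 then i else a.

(** Neither lowering produces the value that the other one changes. *)
Lemma lower_comm (i j a : nat) :
  i != j.+1 -> j != i.+1 -> lower i (lower j a) = lower j (lower i a).
Proof.
rewrite /lower => /negPf nij /negPf nji; have [->|/negPf nj] := eqVneq a j.+1.
  rewrite nji; have [[->]|_] := eqVneq j.+1 i.+1; last by rewrite eqxx.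
  by rewrite if_same.
by have [_|_] := eqVneq a i.+1; rewrite ?nij ?nj.
Qed.

(** An entry sent to [v != i] was already [v]. *)
Lemma count_mem_lower (i v : nat) (s : seq nat) :
  v != i -> count_mem v (map (lower i) s) <= count_mem v s.
Proof.
move=> /negPf nv; rewrite count_map; apply: sub_count => a /=.
by rewrite /lower; case: (a == i.+1); rewrite // eq_sym nv.
Qed.

Lemma delta_tuple_lower (n i : nat) (alpha : n.-tuple nat) :
  {in [:: i.-1; i; i.+1], forall v, count_mem v alpha <= 1} ->
  delta_tuple i alpha = map_tuple (lower i) alpha.
Proof.
move=> c1; rewrite /delta_tuple ifN //; apply/hasPn => v /c1.
by rewrite neq_ltn ltnS => ->.
Qed.

Lemma delta_tuple_lower2 (n i j : nat) (alpha : n.-tuple nat) :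
  uniq alpha -> j \notin [:: i.-1; i; i.+1] ->
  delta_tuple i (delta_tuple j alpha) =
  map_tuple (lower i) (map_tuple (lower j) alpha).
Proof.
move=> u nj; have c1 v : count_mem v alpha <= 1.
  by rewrite count_uniq_mem // leq_b1.
rewrite (@delta_tuple_lower _ j) // delta_tuple_lower // => v vi.
(* Only the multiplicity of [j] can have grown, and [v] differs from [j] by [nj]. *)
apply: leq_trans (c1 v); apply: count_mem_lower.
by apply: contraNneq nj => <-.
Qed.

Lemma perm_tuple_uniq (n : nat) (pi : 'S_n) : uniq (perm_tuple pi).
Proof.
by rewrite map_inj_uniq ?enum_uniq // => k l [] /val_inj/perm_inj.
Qed.

Theorem theorem3p11 (n i j : nat) (hi : 0 < i < n) (hj : 0 < j < n)
    (hij : `|i - j|%N != 1) (pi : 'S_n) :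
  delta hi (delta hj (ufr_of_perm pi)) = delta hj (delta hi (ufr_of_perm pi)).
Proof.
(* On the underlying tuples the case [i = j] is trivial; [delta_tuple_lower2] does not cover it. *)
apply: val_inj => /=; have [->//|nij] := eqVneq i j.
have u := perm_tuple_uniq pi.
rewrite !delta_tuple_lower2 //; try by rewrite !inE; lia.
apply: eq_from_tnth => k; rewrite !tnth_map; apply: lower_comm; lia.
Qed.
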